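(* Let $\mathcal{P}=\langle\Sigma\mid\mathcal{R}\rangle$ be a semigroup presentation and $w_0\in\Sigma^+$ a base word. If there are no words $a,b,p\in\Sigma^+$ satisfying $w_0=ab$, $a=ap$ and $b=pb$ modulo $\mathcal{P}$, then the Squier complex $S(\mathcal{P},w_0)$ is special. In particular, if $[w_0]_{\mathcal{P}}$ is finite, then $S(\mathcal{P},w_0)$ is special.
   Context: A semigroup presentation $\mathcal{P}=\langle\Sigma\mid\mathcal{R}\rangle$ consists of an alphabet $\Sigma$ and a set $\mathcal{R}$ of relations $u=v$ with $u,v\in\Sigma^+$. Here $\Sigma^+$ is the free semigroup of non-empty words and $\Sigma^*=\Sigma^+\cup\{1\}$ also contains the empty word $1$. Convention: if $u=v\in\mathcal{R}$ then $v=u\notin\mathcal{R}$ (in particular $u=u\notin\mathcal{R}$). Two words are equal modulo $\mathcal{P}$ if one can be transformed into the other by finitely many replacements of a subword $u$ by $v$ or $v$ by $u$, with $u=v\in\mathcal{R}$; $[w_0]_{\mathcal{P}}$ is the set of words equal to $w_0$ modulo $\mathcal{P}$. The Squier complex $S(\mathcal{P})$ is the cube complex whose vertices are the words over $\Sigma$; whose oriented edges are $(a,u\to v,b)$ with $a,b\in\Sigma^*$ and $u=v$ or $v=u$ in $\mathcal{R}$, going from $aub$ to $avb$ (and $(a,v\to u,b)$ is the same edge with opposite orientation); and whose $n$-cubes are similarly $(a_1,u_1\to v_1,\dots,a_n,u_n\to v_n,a_{n+1})$, spanned by the vertices $a_1w_1\cdots a_nw_na_{n+1}$ with $w_i\in\{u_i,v_i\}$.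 $S(\mathcal{P},w_0)$ is the connected component containing $w_0$; it is nonpositively curved. A hyperplane is an equivalence class of edges for the equivalence relation generated by: two edges are equivalent if they are parallel sides of some square; oriented hyperplanes $\vec J$ are defined likewise with oriented edges, $-\vec J$ being the opposite orientation; edges in the class are said to be dual to the hyperplane. $J$ is 2-sided if $\vec J\neq-\vec J$; self-intersecting if two edges dual to $J$ are non-parallel sides of some square; self-osculating if there are two oriented edges dual to $\vec J$ with the same initial points or the same terminal points but not belonging to a same square; clean if 2-sided, not self-intersecting and not self-osculating. Two hyperplanes are transverse if edges dual to them, respectively, are non-parallel sides of some square; inter-osculating if they are transverse and there are edges dual to them, respectively, with a common endpoint but not belonging to a same square. A nonpositively curved cube complex is special if its hyperplanes are clean and no two are inter-osculating. *)

(* Defs.v *)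
From mathcomp Require Import all_boot.
From mathcomp Require Import boolp classical_sets cardinality.
From Stdlib Require Import Relations.

Set Implicit Arguments.
Unset Strict Implicit.
Unset Printing Implicit Defensive.

Local Open Scope classical_set_scope.

(* Combinatorial cube complexes.  [cube n] is the type of *oriented* n-cubes:
   n-cubes [0,1]^n with ordered coordinates, each of which is given a direction.
   [face i b c] is the codimension-one face of [c] on which the i-th coordinate
   is 0 ([b = false]) or 1 ([b = true]), and [flip i c] is the same cube as [c]
   with its i-th coordinate reversed.  Thus an (unoriented) n-cube is an orbit
   of 2^n oriented n-cubes; [flip_free] says that no oriented cube is identified
   with another orientation of itself.  The order of the coordinates belongs to
   the cube and is inherited by its faces. *)
Record cube_complex := CubeComplex {
  cube : nat -> Type;
  face : forall n, 'I_n.+1 -> bool -> cube n.+1 -> cube n;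
  flip : forall n, 'I_n -> cube n -> cube n;
  face_face : forall n (i j : 'I_n.+1) a b (c : cube n.+2), i <= j ->
    face i a (face (lift ord0 j) b c) =
    face j b (face (widen_ord (leqnSn n.+1) i) a c);
  flipK : forall n (i : 'I_n) (c : cube n), flip i (flip i c) = c;
  flipC : forall n (i j : 'I_n) (c : cube n),
    flip i (flip j c) = flip j (flip i c);
  face_flip : forall n (i : 'I_n.+1) b (c : cube n.+1),
    face i b (flip i c) = face i (~~ b) c;
  face_flip_lift : forall n (i : 'I_n.+1) (j : 'I_n) b (c : cube n.+1),
    face i b (flip (lift i j) c) = flip j (face i b c);
  flip_free : forall n (c : cube n) (s : seq 'I_n),
    uniq s -> foldr (@flip n) c s = c -> s = [::]
}.

Definition vertex (X : cube_complex) := cube X 0.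
Definition edge (X : cube_complex) := cube X 1.
Definition square (X : cube_complex) := cube X 2.

Section CubeComplexes.
Variable X : cube_complex.
Implicit Types (e f : edge X) (s : square X) (J K : set (edge X)).

Definition source e : vertex X := face ord0 false e.
Definition target e : vertex X := face ord0 true e.
Definition reverse e : edge X := flip ord0 e.

Definition connected : vertex X -> vertex X -> Prop :=
  clos_refl_sym_trans _ (fun x y => exists e, source e = x /\ target e = y).

(* The vertex of an oriented cube all of whose coordinates are 0. *)
Fixpoint corner n : cube X n -> vertex X :=
  match n with
  | 0 => id
  | n'.+1 => fun c => corner (face ord0 false c)
  end.

(* The oriented edge of [c] that leaves [corner c] in the i-th direction. *)
Fixpoint corner_edge n : cube X n.+1 -> 'I_n.+1 -> edge X :=
  match n return cube X n.+1 -> 'I_n.+1 -> edge X with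
  | 0 => fun c _ => c
  | n'.+1 => fun c i =>
      if unlift ord0 i is Some j then corner_edge (face ord0 false c) j
      else corner_edge (face ord_max false c) ord0
  end.

(* The link of a vertex [x] has one vertex for each oriented edge starting at
   [x], and one n-simplex for each oriented (n+1)-cube [c] with [corner c = x];
   the vertices of that simplex are the edges [corner_edge c i].  The complex is
   nonpositively curved when all these links are flag simplicial complexes. *)
Definition link_simplex n (c : cube X n.+1) : set (edge X) :=
  range (corner_edge c).

Definition simplicial_links :=
  (forall n (c : cube X n.+1), injective (corner_edge c)) /\
  (forall n (c c' : cube X n.+1), link_simplex c = link_simplex c' -> c = c').

Definition link_adjacent e f :=
  exists s, link_simplex s = [set e; f].

Definition flag_links :=
  forall n (e : 'I_n.+1 -> edge X), injective e ->
    (forall i j, i != j -> link_adjacent (e i) (e j)) ->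
    exists c : cube X n.+1, link_simplex c = range e.

Definition nonpositively_curved := simplicial_links /\ flag_links.

(* An unoriented edge is represented by either of its two orientations, so that
   (unoriented) hyperplanes are sets of edges stable under [reverse]. *)
Definition same_edge e f := f = e \/ f = reverse e.

Definition opposite_sides e f :=
  exists s (i : 'I_2), e = face i false s /\ f = face i true s.

Definition oriented_parallel : edge X -> edge X -> Prop :=
  clos_refl_sym_trans _ opposite_sides.

Definition parallel : edge X -> edge X -> Prop :=
  clos_refl_sym_trans _ (fun e f => same_edge e f \/ opposite_sides e f).

Definition hyperplane_of e : set (edge X) := [set f | parallel e f].
Definition oriented_hyperplane_of e : set (edge X) :=
  [set f | oriented_parallel e f].

Definition hyperplane J := exists e, J = hyperplane_of e.

Definition opposite (Jo : set (edge X)) : set (edge X) := reverse @` Jo.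

(* [Jo] is one of the oriented hyperplanes underlying [J]. *)
Definition orientation J (Jo : set (edge X)) :=
  exists2 e, J = hyperplane_of e & Jo = oriented_hyperplane_of e.

(* [e] is, up to orientation, a side of [s] on which coordinate [i] is constant;
   two sides are parallel exactly when the same coordinate is constant. *)
Definition side s (i : 'I_2) e := exists b, same_edge (face i b s) e.

Definition nonparallel_sides e f :=
  exists s i j, [/\ i != j, side s i e & side s j f].

Definition in_same_square e f :=
  exists s i j, side s i e /\ side s j f.

Definition common_endpoint e f :=
  exists x, (x = source e \/ x = target e) /\ (x = source f \/ x = target f).

Definition two_sided J := forall Jo, orientation J Jo -> Jo <> opposite Jo.

Definition self_intersecting J :=
  exists e f, [/\ J e, J f & nonparallel_sides e f].

Definition self_osculating J :=
  exists2 Jo, orientation J Jo &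
    exists e f, [/\ Jo e, Jo f, e <> f,
      source e = source f \/ target e = target f & ~ in_same_square e f].

Definition clean J :=
  [/\ two_sided J, ~ self_intersecting J & ~ self_osculating J].

Definition transverse J K :=
  exists e f, [/\ J e, K f & nonparallel_sides e f].

Definition inter_osculating J K :=
  transverse J K /\
  exists e f, [/\ J e, K f, common_endpoint e f & ~ in_same_square e f].

Definition special :=
  [/\ nonpositively_curved,
      forall J, hyperplane J -> clean J
    & forall J K, hyperplane J -> hyperplane K -> J <> K ->
        ~ inter_osculating J K].

Lemma corner_face_false n (c : cube X n.+1) i :
  corner (face i false c) = corner c.
Proof.
elim: n c i => [|n IHn] c i; first by rewrite (ord1 i).
case: (unliftP ord0 i) => [j ->|->] //.
rewrite [LHS]/= face_face // IHn; congr (corner (face _ _ _)).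
exact/val_inj.
Qed.

Lemma connected_face n (c : cube X n.+1) i b :
  connected (corner c) (corner (face i b c)).
Proof.
case: b; last by rewrite corner_face_false; exact: rst_refl.
elim: n c i => [|n IHn] c i.
  by rewrite (ord1 i); apply: rst_step; exists c.
case: (unliftP ord0 i) => [j ->|->].
  rewrite [corner (face _ _ _)]/= face_face // -(corner_face_false c ord0).
  rewrite (_ : widen_ord _ _ = ord0); last exact/val_inj.
  exact: IHn.
rewrite -(corner_face_false c (lift ord0 ord0)).
rewrite -(corner_face_false (face ord0 true c) ord0).
rewrite (_ : face ord0 true c = face (widen_ord (leqnSn n.+1) ord0) true c);
  last by congr (face _ _ _); exact/val_inj.
by rewrite -face_face //; exact: IHn.
Qed.

Lemma connected_flip n (c : cube X n) i :
  connected (corner c) (corner (flip i c)).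
Proof.
case: n c i => [|n] c i; first by case: i.
rewrite -(corner_face_false (flip i c) i) face_flip; exact: connected_face.
Qed.

Variable x : vertex X.

Definition component_cube n := {c : cube X n | connected x (corner c)}.

Definition component_face n (i : 'I_n.+1) b (c : component_cube n.+1) :
    component_cube n :=
  exist _ (face i b (sval c))
    (rst_trans _ _ _ _ _ (svalP c) (connected_face (sval c) i b)).

Definition component_flip n (i : 'I_n) (c : component_cube n) :
    component_cube n :=
  exist _ (flip i (sval c))
    (rst_trans _ _ _ _ _ (svalP c) (connected_flip (sval c) i)).

Lemma component_cube_inj n (c c' : component_cube n) :
  sval c = sval c' -> c = c'.
Proof. by case: c c' => [c p] [c' p'] /= E; exact: eq_exist. Qed.

Lemma component_flip_free n (c : component_cube n) (s : seq 'I_n) :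
  uniq s -> foldr (@component_flip n) c s = c -> s = [::].
Proof.
move=> us /(congr1 sval) E; apply: (@flip_free X n (sval c)) => //.
by rewrite -[RHS]E; elim: s {us E} => //= i s ->.
Qed.

Definition component : cube_complex.
Proof.
refine (@CubeComplex component_cube component_face component_flip
          _ _ _ _ _ component_flip_free) => *; apply: component_cube_inj => /=.
- exact: face_face.
- exact: flipK.
- exact: flipC.
- exact: face_flip.
- exact: face_flip_lift.
Defined.

End CubeComplexes.

Record presentation (Sigma : Type) := Presentation {
  defining_relation : seq Sigma -> seq Sigma -> Prop;
  defining_relation_nonempty : forall u v,
    defining_relation u v -> u <> [::] /\ v <> [::];
  defining_relation_asym : forall u v,
    defining_relation u v -> ~ defining_relation v u
}.

Section Squier.
Variables (Sigma : Type) (P : presentation Sigma).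
Local Notation word := (seq Sigma).
Implicit Types a u v w : word.

Definition oriented_relation u v :=
  defining_relation P u v \/ defining_relation P v u.

Definition rewriting_step w w' :=
  exists a b u v,
    [/\ defining_relation P u v, w = a ++ u ++ b & w' = a ++ v ++ b].

Definition eqmod : word -> word -> Prop :=
  clos_refl_sym_trans _ rewriting_step.

Definition word_class w : set word := [set w' | eqmod w w'].

(* [Segment a1 u1 v1 (... (Segment an un vn (Word b)))] stands for
   (a1, u1 -> v1, ..., an, un -> vn, b). *)
Inductive squier_symbol :=
  | Word of word
  | Segment of word & word & word & squier_symbol.

Fixpoint dim (c : squier_symbol) : nat :=
  if c is Segment _ _ _ c' then (dim c').+1 else 0.

Fixpoint over_relations (c : squier_symbol) : Prop :=
  if c is Segment _ u v c' then oriented_relation u v /\ over_relations c'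
  else True.

Definition prepend w (c : squier_symbol) :=
  match c with
  | Word a => Word (w ++ a)
  | Segment a u v c' => Segment (w ++ a) u v c'
  end.

Fixpoint symbol_face (i : nat) (b : bool) (c : squier_symbol) {struct c} :=
  match c, i with
  | Word _, _ => c
  | Segment a u v c', 0 => prepend (a ++ (if b then v else u)) c'
  | Segment a u v c', i'.+1 => Segment a u v (symbol_face i' b c')
  end.

Fixpoint symbol_flip (i : nat) (c : squier_symbol) {struct c} :=
  match c, i with
  | Word _, _ => c
  | Segment a u v c', 0 => Segment a v u c'
  | Segment a u v c', i'.+1 => Segment a u v (symbol_flip i' c')
  end.

Definition squier_cube n := {c : squier_symbol | dim c = n /\ over_relations c}.

Lemma squier_cube_inj n (c c' : squier_cube n) : sval c = sval c' -> c = c'.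
Proof. by case: c c' => [c p] [c' p'] /= E; exact: eq_exist. Qed.

Lemma dim_prepend w c : dim (prepend w c) = dim c.
Proof. by case: c. Qed.

Lemma over_relations_prepend w c :
  over_relations (prepend w c) = over_relations c.
Proof. by case: c. Qed.

Lemma prepend_prepend w w' c : prepend w (prepend w' c) = prepend (w ++ w') c.
Proof. by case: c => [a|a u v c] /=; rewrite catA. Qed.

Lemma symbol_face_prepend w i b c :
  symbol_face i b (prepend w c) = prepend w (symbol_face i b c).
Proof. by case: c i => [a|a u v c] [|i] //=; rewrite prepend_prepend catA. Qed.

Lemma symbol_flip_prepend w i c :
  symbol_flip i (prepend w c) = prepend w (symbol_flip i c).
Proof. by case: c i => [a|a u v c] [|i]. Qed.

Lemma dim_symbol_face i b c : i < dim c ->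
  (dim (symbol_face i b c)).+1 = dim c.
Proof.
elim: c i => [w|a u v c IHc] [|i] //= lti; first by rewrite dim_prepend.
by rewrite IHc.
Qed.

Lemma over_relations_face i b c :
  over_relations c -> over_relations (symbol_face i b c).
Proof.
elim: c i => [a|a u v c IHc] [|i] //= [ruv rc].
  by rewrite over_relations_prepend.
by split=> //; exact: IHc.
Qed.

Lemma symbol_face_subproof n (i : 'I_n.+1) b (c : squier_cube n.+1) :
  dim (symbol_face i b (sval c)) = n /\
  over_relations (symbol_face i b (sval c)).
Proof.
case: c => c /= [dc rc]; split; last by apply: over_relations_face.
by apply: succn_inj; rewrite dim_symbol_face ?dc.
Qed.

Lemma dim_symbol_flip i c : dim (symbol_flip i c) = dim c.
Proof. by elim: c i => [w|a u v c IHc] [|i] //=; rewrite IHc. Qed.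

Lemma over_relations_flip i c :
  over_relations c -> over_relations (symbol_flip i c).
Proof.
elim: c i => [w|a u v c IHc] [|i] //= [ruv rc]; split=> //.
  by case: ruv; [right|left].
exact: IHc.
Qed.

Lemma symbol_flip_subproof n (i : 'I_n) (c : squier_cube n) :
  dim (symbol_flip i (sval c)) = n /\
  over_relations (symbol_flip i (sval c)).
Proof.
case: c => c /= [dc rc]; split; first by rewrite dim_symbol_flip.
exact: over_relations_flip.
Qed.

Definition squier_face n (i : 'I_n.+1) b (c : squier_cube n.+1) :
    squier_cube n :=
  exist _ _ (symbol_face_subproof i b c).

Definition squier_flip n (i : 'I_n) (c : squier_cube n) : squier_cube n :=
  exist _ _ (symbol_flip_subproof i c).

Lemma symbol_face_face i j b b' c : i <= j ->
  symbol_face i b (symbol_face j.+1 b' c) =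
  symbol_face j b' (symbol_face i b c).
Proof.
elim: c i j => [w|p u v c IHc] [|i] [|j] //= le_ij.
- by rewrite symbol_face_prepend.
- by rewrite symbol_face_prepend.
- by rewrite IHc.
Qed.

Lemma symbol_flipK i c : symbol_flip i (symbol_flip i c) = c.
Proof. by elim: c i => [w|p u v c IHc] [|i] //=; rewrite IHc. Qed.

Lemma symbol_flipC i j c :
  symbol_flip i (symbol_flip j c) = symbol_flip j (symbol_flip i c).
Proof. by elim: c i j => [w|p u v c IHc] [|i] [|j] //=; rewrite IHc. Qed.

Lemma symbol_face_flip i b c :
  symbol_face i b (symbol_flip i c) = symbol_face i (~~ b) c.
Proof.
by elim: c i => [w|p u v c IHc] [|i] //=; [case b|rewrite IHc].
Qed.

Lemma symbol_face_flip_bump i j b c :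
  symbol_face i b (symbol_flip (bump i j) c) =
  symbol_flip j (symbol_face i b c).
Proof.
elim: c i j => [w|p u v c IHc] [|i] [|j] //=.
- by rewrite symbol_flip_prepend.
- by rewrite symbol_flip_prepend.
- by rewrite bumpS /= IHc.
Qed.

Fixpoint sides_at (i : nat) (c : squier_symbol) {struct c} : word * word :=
  match c, i with
  | Word _, _ => ([::], [::])
  | Segment _ u v _, 0 => (u, v)
  | Segment _ _ _ c', i'.+1 => sides_at i' c'
  end.

Lemma sides_at_flip i c :
  sides_at i (symbol_flip i c) = ((sides_at i c).2, (sides_at i c).1).
Proof. by elim: c i => [w|p u v c IHc] [|i] /=. Qed.

Lemma sides_at_flip_neq i j c : i != j ->
  sides_at i (symbol_flip j c) = sides_at i c.
Proof. by elim: c i j => [w|p u v c IHc] [|i] [|j] //=; rewrite eqSS; exact: IHc. Qed.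

Lemma sides_at_neq i c : over_relations c -> i < dim c ->
  (sides_at i c).1 <> (sides_at i c).2.
Proof.
elim: c i => [w|p u v c IHc] [|i] //= [ruv rc] lti; last exact: IHc.
by move=> uv; rewrite uv in ruv; case: ruv => r; exact: (defining_relation_asym r r).
Qed.

Lemma squier_flip_free n (c : squier_cube n) (s : seq 'I_n) :
  uniq s -> foldr (@squier_flip n) c s = c -> s = [::].
Proof.
case: s => [//|i s] /= /andP[iNs _] /(congr1 sval) /= E.
have [dc rc] := svalP c.
have := @sides_at_neq i (sval c) rc; rewrite dc ltn_ord => /(_ isT); case.
have sE : sides_at i (sval (foldr (@squier_flip n) c s)) = sides_at i (sval c).
  elim: s iNs {E} => //= j s IHs; rewrite inE negb_or => /andP[ij /IHs <-].
  exact: sides_at_flip_neq.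
by rewrite -{1}E sides_at_flip sE.
Qed.

Definition squier_complex : cube_complex.
Proof.
refine (@CubeComplex squier_cube squier_face squier_flip
          _ _ _ _ _ squier_flip_free) => *; apply: squier_cube_inj => /=.
- exact: symbol_face_face.
- exact: symbol_flipK.
- exact: symbol_flipC.
- exact: symbol_face_flip.
- exact: symbol_face_flip_bump.
Defined.

Definition squier_vertex w : vertex squier_complex :=
  exist _ (Word w) (conj (erefl 0) I).

Definition squier_component w : cube_complex := component (squier_vertex w).

End Squier.

(* Main.v *)
Require Import Defs.
From mathcomp Require Import all_boot.
From mathcomp Require Import boolp classical_sets cardinality.
From Stdlib Require Import Relations Setoid Morphisms.

(* An edge (a, u -> v, b) of a hyperplane determines u -> v, and determines a and
   b modulo P.  So two edges of the same hyperplane, or of two transverse ones,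
   that leave the same word w without spanning a square see the same word split
   in two incompatible ways; cutting w at one of the two occurrences gives
   w = AB with A = Ap and B = pB modulo P.  Nonpositive curvature holds without
   any assumption: a cube based at w is a left-to-right list of disjoint
   occurrences in w of sides of relations, and disjointness is a pairwise
   condition.  If the class of w0 is finite, then w0 = ab, a = ap is impossible
   because the words a p^n b are all equal to w0. *)

Set Implicit Arguments.
Unset Strict Implicit.
Unset Printing Implicit Defensive.

Local Open Scope classical_set_scope.

Lemma cat_eq_cat_split (T : Type) (a b c d : seq T) :
  a ++ b = c ++ d -> size a <= size c -> exists2 x, c = a ++ x & b = x ++ d.
Proof.
elim: a c => [|t a IHa] [|t' c] //=.
- by move=> ->; exists [::].
- by move=> ->; exists (t' :: c).
move=> [<- /IHa] IH /IH[x -> ->]; by exists x.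
Qed.

Section SquierComplex.
Variables (Sigma : Type) (P : presentation Sigma).
Implicit Types (a b m p u v w x : seq Sigma) (c E F : squier_symbol Sigma).

(** * Equality modulo [P] as a congruence *)

#[local] Instance eqmod_equivalence : Equivalence (eqmod P).
Proof.
split; [exact: rst_refl | exact: rst_sym | exact: rst_trans].
Qed.

#[local] Hint Extern 0 (eqmod _ _ _) => reflexivity : core.

#[local] Instance cat_eqmod_proper :
  Proper (eqmod P ==> eqmod P ==> eqmod P) (@cat Sigma).
Proof.
move=> a a' aa' b b' bb'; transitivity (a' ++ b).
  elim: aa' => {a a'} [_ _ [c [d [u [v [r -> ->]]]]]|w|w w' _ IH|w1 w2 w3 _ IH _ IH'].
  - by apply: rst_step; exists c, (d ++ b), u, v; rewrite -!catA.
  - reflexivity.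
  - by symmetry.
  - by transitivity (w2 ++ b).
elim: bb' => {b b'} [_ _ [c [d [u [v [r -> ->]]]]]|w|w w' _ IH|w1 w2 w3 _ IH _ IH'].
- by apply: rst_step; exists (a' ++ c), d, u, v; rewrite -!catA.
- reflexivity.
- by symmetry.
- by transitivity (a' ++ w2).
Qed.

Lemma oriented_relation_eqmod u v : oriented_relation P u v -> eqmod P u v.
Proof.
suff H u' v' : defining_relation P u' v' -> eqmod P u' v'.
  by case=> /H // ?; symmetry.
by move=> r; apply: rst_step; exists [::], [::], u', v'; rewrite !cats0.
Qed.

Lemma oriented_relation_nonempty u v : oriented_relation P u v -> u <> [::].
Proof. by case=> /defining_relation_nonempty[]. Qed.

Lemma eqmod_nil a b : eqmod P a b -> (a = [::] <-> b = [::]).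
Proof.
elim=> {a b} [_ _ [a [b [u [v [r -> ->]]]]]|w|w w' _ IH|w1 w2 w3 _ IH _ IH'];
  [|by []|by rewrite IH|by rewrite IH].
have [] := defining_relation_nonempty r.
by case: a u v {r} => [|? ?] [|? ?] [|? ?].
Qed.

(** * Absorbing factorizations of a word *)

Definition absorbing w := exists a b p : seq Sigma,
  (a <> [::] /\ b <> [::] /\ p <> [::]) /\
  [/\ eqmod P w (a ++ b), eqmod P a (a ++ p) & eqmod P b (p ++ b)].

(** The empty word is alone in its class, because relations have nonempty sides. So [a = 1] or
    [b = 1] would force [p = 1]. *)
Lemma absorbing_intro w a b p : p <> [::] -> eqmod P w (a ++ b) ->
  eqmod P a (a ++ p) -> eqmod P b (p ++ b) -> absorbing w.
Proof.
move=> p0 wab aap bpb; exists a, b, p; split=> //; split.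
  by move=> a0; move: aap; rewrite a0 => /eqmod_nil[/(_ erefl)/p0].
by split=> // b0; move: bpb; rewrite b0 cats0 => /eqmod_nil[/(_ erefl)/p0].
Qed.

Lemma absorbing_infinite w : absorbing w -> ~ finite_set (word_class P w).
Proof.
move=> [a [b [p [[_ [_ p0]] [wab aap _]]]]] fin.
have pump n : eqmod P w (a ++ flatten (nseq n p) ++ b).
  elim: n => //= n IHn.
  by rewrite -catA catA -aap.
have /finite_seqP[s sE] := finite_image size fin.
(* [n] exceeds every length occurring in the class, while [n] copies of the nonempty word [p]
   already have length at least [n]. *)
pose n := (\max_(i <- s) i).+1.
have : (size @` word_class P w) (size (a ++ flatten (nseq n p) ++ b)).
  by exists (a ++ flatten (nseq n p) ++ b); first exact: pump.
rewrite sE => inS; have := leq_bigmax_seq (P := xpredT) (F := id) _ inS isT.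
apply/negP; rewrite -ltnNge -/n !size_cat size_flatten /shape map_nseq sumn_nseq.
apply: leq_trans (leq_addl _ _); apply: leq_trans (leq_addr _ _).
by rewrite -mulnS leq_pmull //; case: (p) p0.
Qed.

(** If the second occurrence of [u] is shifted to the right by a nonempty [x], then [a' = ax] and
    [ub = xub'] as words. Modulo [P] this reads [a = ax] and [ub = x(ub)], so [x] is absorbed on
    both sides of the cut between [a] and [ub]. *)
Lemma shifted_occurrences_absorbing w a b a' b' u :
  eqmod P w (a ++ u ++ b) -> a ++ u ++ b = a' ++ u ++ b' ->
  eqmod P a a' -> eqmod P b b' -> absorbing w \/ a = a' /\ b = b'.
Proof.
wlog le_aa' : a b a' b' / size a <= size a' => [H wE E aa' bb'|].
  case: (leqP (size a) (size a')) => [le|/ltnW le]; first exact: H.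
  case: (H a' b' a b) => //; [by rewrite -E|by symmetry|by symmetry|by left|].
  by case=> -> ->; right.
move=> wE E aa' bb'; have [[|y x] a'E uE] := cat_eq_cat_split E le_aa'.
  right; split; first by rewrite a'E cats0.
  by have := congr1 (drop (size u)) uE; rewrite /= !drop_size_cat.
left; apply: (absorbing_intro (p := y :: x)) wE _ _ => //.
  by rewrite -a'E.
by rewrite {1}uE -bb'.
Qed.

(** * Cubes as lists of disjoint occurrences in their corner word *)

Fixpoint corner_word c :=
  match c with
  | Word b => b
  | Segment a u _ c' => a ++ u ++ corner_word c'
  end.

(** Counterpart on symbols of the family [corner_edge]: one segment is kept and the others collapse
    to their left-hand sides. The order from left to right is what later makes this list recoverable
    from its set of elements. *)
Fixpoint corner_edges c :=
  match c with
  | Word _ => [::]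
  | Segment a u v c' =>
      Segment a u v (Word (corner_word c'))
        :: map (prepend (a ++ u)) (corner_edges c')
  end.

Definition lword E := if E is Segment a _ _ _ then a else [::].
Definition rword E := if E is Segment _ _ _ c then corner_word c else [::].
Definition lhs E := (sides_at 0 E).1.

Definition edge_symbol E := dim E = 1 /\ over_relations P E.

Lemma edge_symbol_eta E : dim E = 1 ->
  E = Segment (lword E) (lhs E) (sides_at 0 E).2 (Word (rword E)).
Proof. by case: E => // a u v [b|]. Qed.

Lemma edge_symbol_lhs E : edge_symbol E -> lhs E <> [::].
Proof.
by case: E => [?|a u v c] [//= _ [/oriented_relation_nonempty]].
Qed.

Lemma corner_word_edge E : dim E = 1 ->
  corner_word E = lword E ++ lhs E ++ rword E.
Proof. by case: E => // a u v [b|]. Qed.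

Definition precedes E F := size (lword E) + size (lhs E) <= size (lword F).

Lemma corner_word_prepend w c : corner_word (prepend w c) = w ++ corner_word c.
Proof. by case: c => //= *; rewrite -!catA. Qed.

Lemma lword_prepend w E : dim E = 1 -> lword (prepend w E) = w ++ lword E.
Proof. by case: E. Qed.

Lemma lhs_prepend w E : lhs (prepend w E) = lhs E.
Proof. by case: E. Qed.

Lemma prepend_inj w : injective (prepend w).
Proof.
have wI : injective (cat w).
  by move=> a b /(congr1 (drop (size w))); rewrite !drop_size_cat.
move=> [a|a u v c] [a'|a' u' v' c'] //=.
  by case=> /wI ->.
by case=> /wI -> -> -> ->.
Qed.

Lemma size_corner_edges c : size (corner_edges c) = dim c.
Proof. by elim: c => //= a u v c IHc; rewrite size_map IHc. Qed.

Lemma all_corner_edges c : all (fun E => dim E == 1) (corner_edges c).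
Proof.
elim: c => //= a u v c IHc; rewrite all_map; apply: sub_all IHc => E /=.
by rewrite dim_prepend.
Qed.

Lemma corner_edges_precedes c : pairwise precedes (corner_edges c).
Proof.
elim: c => //= a u v c IHc; apply/andP; split.
  rewrite all_map; apply: sub_all (all_corner_edges c) => E /eqP dE /=.
  by rewrite /precedes lword_prepend // !size_cat /= leq_addr.
rewrite pairwise_map; apply: sub_in_pairwise (all_corner_edges c) IHc.
move=> E F; rewrite !unfold_in => /eqP dE /eqP dF /=.
by rewrite /precedes !lword_prepend // lhs_prepend !size_cat -addnA leq_add2l.
Qed.

(** The first edge reveals the first segment and the corner word of the tail; cancelling the common
    prefix in the other edges allows the recursion. For a vertex the list is empty and the corner
    word alone decides. *)
Lemma corner_edges_inj c c' : corner_word c = corner_word c' ->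
  corner_edges c = corner_edges c' -> c = c'.
Proof.
elim: c c' => [b|a u v c IHc] [b'|a' u' v' c'] //=; first by move=> ->.
by move=> _ [<- <- <- wcc'] /(inj_map (@prepend_inj _)) /(IHc _ wcc') ->.
Qed.

(* The prefix [q] is what the recursion has already consumed. *)
Lemma precedes_corner_edges (T : Type) (f : T -> squier_symbol Sigma) q w s :
  (forall t, edge_symbol (f t)) -> (forall t, corner_word (f t) = q ++ w) ->
  all (fun t => size q <= size (lword (f t))) s ->
  pairwise (relpre f precedes) s ->
  exists c, [/\ over_relations P c, corner_word c = w
              & map (prepend q) (corner_edges c) = map f s].
Proof.
move=> edge_f; elim: s q w => [|t s IHs] q w wf; first by exists (Word w).
move=> /= /andP[qt _] /andP[ts ps]; have [dt rt] := edge_f t.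
have ft := edge_symbol_eta dt.
have := wf t; rewrite corner_word_edge // => wt.
(* [x] is the gap between the consumed prefix and the next occurrence; it becomes the outer word of
   the new segment. *)
have [x tx wx] := cat_eq_cat_split (esym wt) qt.
have [|||c [rc wc cE]] := IHs (q ++ x ++ lhs (f t)) (rword (f t)).
- by move=> t'; rewrite wf wx -!catA.
- by apply: sub_all ts => t' /=; rewrite /precedes tx !size_cat addnA.
- exact: ps.
exists (Segment x (lhs (f t)) (sides_at 0 (f t)).2 c); split=> /=.
- by split=> //; move: rt; rewrite ft => -[].
- by rewrite wc.
rewrite wc -tx -ft -cE -map_comp; congr (_ :: _); apply: eq_map => E /=.
by rewrite prepend_prepend.
Qed.

(** * Relative position of edges modulo [P] *)

Definition left_of E F := exists m,
  eqmod P (lword F) (lword E ++ lhs E ++ m) /\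
  eqmod P (rword E) (m ++ lhs F ++ rword F).

(** Asking for the left-hand sides only modulo [P] makes this relation blind to orientation, hence
    an invariant of unoriented hyperplanes. *)
Definition eqmod_edge E F :=
  [/\ eqmod P (lword E) (lword F), eqmod P (lhs E) (lhs F)
    & eqmod P (rword E) (rword F)].

#[local] Instance eqmod_edge_equivalence : Equivalence eqmod_edge.
Proof.
split=> [E|E F [l u r]|E F G [l u r] [l' u' r']]; first by [].
  by split; symmetry.
by split; [rewrite l|rewrite u|rewrite r].
Qed.

Lemma eqmod_edge_flip E : edge_symbol E -> eqmod_edge (symbol_flip 0 E) E.
Proof.
case: E => [?|a u v c] [//= _ [ruv _]]; split; try reflexivity.
by rewrite /lhs /=; symmetry; exact: oriented_relation_eqmod.
Qed.

(** This invariance carries [left_of] from two sides of one square to arbitrary edges of the two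
    hyperplanes. *)
Lemma left_of_eqmod E E' F F' : eqmod_edge E E' -> eqmod_edge F F' ->
  left_of E F -> left_of E' F'.
Proof.
by move=> [l u r] [l' u' r'] [m [lm rm]]; exists m; rewrite -l -u -r -l' -u' -r'.
Qed.

(** For [E = (a, u -> v, b)] the witness [m] gives [a = aum] and [b = mub], so [p = um] is absorbed
    at the cut between [a] and [ub]. *)
Lemma left_of_self_absorbing E w : edge_symbol E ->
  eqmod P w (corner_word E) -> left_of E E -> absorbing w.
Proof.
move=> eE; have := edge_symbol_lhs eE; rewrite corner_word_edge; last by case: eE.
move=> u0 wE [m [lm rm]].
apply: (absorbing_intro (p := lhs E ++ m)) wE lm _.
  by case: (lhs E) u0.
by rewrite {1}rm catA.
Qed.

(** Let [E] and [F] have outer words [a, b] and [c, d], with sides [u] and [u'], so that [c = aum]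
    and [b = mu'd] modulo [P]. If [F] starts before [E], then [a = cx] and [p = umx] is absorbed
    between [a] and [ub]. If [F] starts inside [u], then [c = ax] and [u = xy] with [y] nonempty,
    and [p = ym] is absorbed between [c] and [yb]. Otherwise the two occurrences are disjoint in the
    right order. *)
Lemma left_of_precedes E F w : edge_symbol E ->
  edge_symbol F -> eqmod P w (corner_word E) -> corner_word E = corner_word F ->
  left_of E F -> absorbing w \/ precedes E F.
Proof.
move=> eE [dF _]; have := edge_symbol_lhs eE; case: eE => dE _.
rewrite /precedes /left_of !corner_word_edge //.
move: (lword E) (lhs E) (rword E) (lword F) (lhs F) (rword F).
move=> a u b c u' d u0 wE ab [m [lm rm]].
have [le_ac|/ltnW le_ca] := leqP (size a) (size c); last first.
  have [x ax xd] := cat_eq_cat_split (esym ab) le_ca; left.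
  apply: (absorbing_intro (p := u ++ m ++ x)) wE _ _; first by case: (u) u0.
    by rewrite {1}ax lm -!catA.
  by rewrite {1}rm xd -!catA.
have [x cx ux] := cat_eq_cat_split ab le_ac.
have [le_ux|lt_xu] := leqP (size u) (size x).
  by right; rewrite cx size_cat leq_add2l.
have [[|s y] uE yb] := cat_eq_cat_split (esym ux) (ltnW lt_xu).
  by move: lt_xu; rewrite uE cats0 ltnn.
left; apply: (@absorbing_intro _ c ((s :: y) ++ b) ((s :: y) ++ m)) => //.
- by rewrite wE cx uE -!catA.
- by rewrite {1}lm cx uE -!catA.
- by rewrite {1}rm yb -!catA.
Qed.

(** * Corners and cubes of the component of [w0] *)

Lemma corner_word_face i c : corner_word (symbol_face i false c) = corner_word c.
Proof.
elim: c i => [//|a u v c IHc] [|i] /=; last by rewrite IHc.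
by rewrite corner_word_prepend -catA.
Qed.

Lemma corner_edges_prepend w c :
  corner_edges (prepend w c) = map (prepend w) (corner_edges c).
Proof.
case: c => //= a u v c; rewrite -map_comp; congr (_ :: _).
by apply: eq_map => E /=; rewrite prepend_prepend catA.
Qed.

Lemma cornerE n (c : cube (squier_complex P) n) :
  corner c = squier_vertex P (corner_word (sval c)).
Proof.
elim: n c => [|n IHn] c; last by rewrite /= IHn /= corner_word_face.
by apply: squier_cube_inj => /=; case: c => -[b|a u v c] [].
Qed.

Lemma connected_eqmod (x y : vertex (squier_complex P)) : connected x y ->
  eqmod P (corner_word (sval x)) (corner_word (sval y)).
Proof.
elim=> {x y} [_ _ [e [<- <-]]|x|x y _ IH|x y z _ IH _ IH'] /=.
- case: e => c [dc rc] /=; case: c dc rc => [//|a u v [b|//]] _ /= [/oriented_relation_eqmod ruv _].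
  by rewrite -!catA ruv.
- exact: rst_refl.
- exact: rst_sym.
- exact: rst_trans IH IH'.
Qed.

Variable w0 : seq Sigma.
Local Notation Y := (squier_component P w0).
Implicit Types (e f g : edge Y) (s : square Y).

Definition symbol n (c : cube Y n) : squier_symbol Sigma := sval (sval c).

Lemma symbol_inj n : injective (@symbol n).
Proof. by move=> c c' E; apply/component_cube_inj/squier_cube_inj. Qed.

Lemma dim_symbol n (c : cube Y n) : dim (symbol c) = n.
Proof. by case: c => [[c []]]. Qed.

Lemma over_relations_symbol n (c : cube Y n) : over_relations P (symbol c).
Proof. by case: c => [[c []]]. Qed.

Lemma edge_symbol_symbol e : edge_symbol (symbol e).
Proof. by split; [exact: dim_symbol | exact: over_relations_symbol]. Qed.

Lemma eqmod_corner_word n (c : cube Y n) : eqmod P w0 (corner_word (symbol c)).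
Proof.
by have := svalP c; rewrite /= cornerE => /connected_eqmod.
Qed.

(** Membership in the component is tested at the corner, which depends only on the corner word; here
    that word is shared with a cube already in the component. *)
Lemma cube_of_symbol n k (d : cube Y k) (c : squier_symbol Sigma) :
  dim c = n -> over_relations P c -> corner_word c = corner_word (symbol d) ->
  exists C : cube Y n, symbol C = c.
Proof.
move=> dc rc cd; pose C : squier_cube P n := exist _ c (conj dc rc).
have HC : connected (squier_vertex P w0) (@corner (squier_complex P) n C).
  by rewrite cornerE /= cd -cornerE; exact: (svalP d).
by exists (exist _ C HC).
Qed.

(** * Links of vertices and nonpositive curvature *)

Lemma symbol_corner_edge n (c : cube Y n.+1) (i : 'I_n.+1) :
  symbol (corner_edge c i) = nth (Word [::]) (corner_edges (symbol c)) i.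
Proof.
elim: n c i => [|n IHn] c i.
  rewrite (ord1 i) /=; have := dim_symbol c.
  by case: (symbol c) => // a u v [].
have faceE k : symbol (component_face k false c) = symbol_face k false (symbol c).
  by [].
rewrite [corner_edge c i]/=; case: unliftP => [j|] ->; rewrite IHn faceE;
  have := dim_symbol c; case: (symbol c) => //= a u v c' [dc'].
  rewrite corner_edges_prepend (nth_map (Word [::])) //.
  by rewrite size_corner_edges dc'.
by rewrite corner_word_face.
Qed.

Lemma corner_word_corner_edge n (c : cube Y n.+1) (i : 'I_n.+1) :
  corner_word (symbol (corner_edge c i)) = corner_word (symbol c).
Proof.
elim: n c i => [//|n IHn] c i /=.
by case: unliftP => [j|] _; rewrite IHn; exact: corner_word_face.
Qed.

Lemma corner_edge_precedes n (c : cube Y n.+1) (i j : 'I_n.+1) : i < j ->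
  precedes (symbol (corner_edge c i)) (symbol (corner_edge c j)).
Proof.
move=> ij; rewrite !symbol_corner_edge.
have /(pairwiseP (Word [::])) := corner_edges_precedes (symbol c).
by apply; rewrite // inE size_corner_edges dim_symbol.
Qed.

Lemma precedes_lt e f : precedes (symbol e) (symbol f) ->
  size (lword (symbol e)) < size (lword (symbol f)).
Proof.
apply: leq_trans; rewrite -addn1 leq_add2l.
by have := edge_symbol_lhs (edge_symbol_symbol e); case: lhs.
Qed.

Lemma corner_edge_inj n (c : cube Y n.+1) : injective (corner_edge c).
Proof.
have lt_neq (i j : 'I_n.+1) : i < j -> corner_edge c i <> corner_edge c j.
  by move=> /(corner_edge_precedes c)/precedes_lt + ij; rewrite ij ltnn.
move=> i j ij; case: (ltngtP i j) => [/lt_neq/(_ ij)[]|/lt_neq|]; last exact: ord_inj.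
by rewrite ij => /(_ erefl).
Qed.

(** The list of corner edges is strictly sorted by starting position, so the set of its elements
    determines it, and [corner_edges_inj] then recovers the cube. *)
Lemma link_simplex_inj n (c c' : cube Y n.+1) :
  link_simplex c = link_simplex c' -> c = c'.
Proof.
have size_edges (d : cube Y n.+1) : size (corner_edges (symbol d)) = n.+1.
  by rewrite size_corner_edges dim_symbol.
move=> cc'; apply/symbol_inj/corner_edges_inj.
  have [i _ ci] : link_simplex c' (corner_edge c ord0) by rewrite -cc'; exists ord0.
  by rewrite -(corner_word_corner_edge c ord0) -ci corner_word_corner_edge.
(* [Sigma] is an arbitrary type, so the decidable equality required by [irr_sorted_eq] comes from
   the classical structure. *)
pose lt (E F : {classic squier_symbol Sigma}) :=
  size (lword (E : squier_symbol Sigma)) < size (lword (F : squier_symbol Sigma)).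
pose edges (d : cube Y n.+1) : seq {classic squier_symbol Sigma} :=
  corner_edges (symbol d).
pose E0 : {classic squier_symbol Sigma} := Word [::].
have sorted_edges (d : cube Y n.+1) : sorted lt (corner_edges (symbol d)).
  apply: pairwise_sorted; apply/(pairwiseP (Word [::])) => i j.
  rewrite !inE !size_edges => ni nj ij.
  have := corner_edge_precedes d (i := Ordinal ni) (j := Ordinal nj) ij.
  by move/precedes_lt; rewrite !symbol_corner_edge.
have sub_edges (d d' : cube Y n.+1) : link_simplex d = link_simplex d' ->
    {subset edges d <= edges d'}.
  move=> dd' E /(nthP E0)[i]; rewrite size_edges => ni <-.
  have [j _ dj] : link_simplex d' (corner_edge d (Ordinal ni)).
    by rewrite -dd'; exists (Ordinal ni).
  rewrite (_ : nth _ _ _ = nth E0 (edges d') j); first by rewrite mem_nth ?size_edges.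
  by rewrite -[LHS](symbol_corner_edge d (Ordinal ni)) -dj symbol_corner_edge.
apply: (@irr_sorted_eq _ lt) (sorted_edges c) (sorted_edges c') _.
- by move=> ? ? ?; exact: ltn_trans.
- by move=> ?; exact: ltnn.
by move=> E; apply/idP/idP; apply: sub_edges.
Qed.

(** Sorting the edges by starting position turns pairwise disjointness into a left-to-right list of
    occurrences, from which [precedes_corner_edges] with empty prefix assembles a cube. *)
Lemma flag_cube n (e : 'I_n.+1 -> edge Y) :
  (forall i, corner_word (symbol (e i)) = corner_word (symbol (e ord0))) ->
  (forall i j, i != j ->
    precedes (symbol (e i)) (symbol (e j)) \/
    precedes (symbol (e j)) (symbol (e i))) ->
  exists c : cube Y n.+1, link_simplex c = range e.
Proof.
move=> same_corner prec.
pose key (i : 'I_n.+1) := size (lword (symbol (e i))).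
pose s := sort (relpre key leq) (enum 'I_n.+1).
have mem_s i : i \in s by rewrite mem_sort mem_enum.
have size_s : size s = n.+1 by rewrite size_sort size_enum_ord.
have prec_s : pairwise (relpre (@symbol 1 \o e) precedes) s.
  have : pairwise (relpre key leq) s.
    rewrite -sorted_pairwise; last by move=> ? ? ?; exact: leq_trans.
    by apply: sort_sorted => ? ?; exact: leq_total.
  have : pairwise [rel i j | i != j] s.
    by rewrite -uniq_pairwise sort_uniq enum_uniq.
  move=> H1 H2; have := conj H1 H2; move/andP; rewrite -pairwise_relI.
  (* If the later edge preceded the earlier one, its key would be strictly smaller, against the
     sorting. *)
  apply: sub_pairwise => i j /= /andP[/prec[//|/precedes_lt ji]].
  by rewrite leqNgt ji.
have [|||c [rc wc cE]] := precedes_corner_edges (q := [::])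
    (w := corner_word (symbol (e ord0))) _ _ _ prec_s.
- by move=> i; exact: edge_symbol_symbol.
- exact: same_corner.
- exact/allP.
have prepend0 : map (prepend [::]) (corner_edges c) = corner_edges c.
  by rewrite -[RHS]map_id; apply: eq_map => -[].
rewrite prepend0 in cE.
have dc : dim c = n.+1 by rewrite -size_corner_edges cE size_map.
have [C CE] := cube_of_symbol dc rc wc.
have edgeE (k : 'I_n.+1) : corner_edge C k = e (nth ord0 s k).
  apply: symbol_inj; rewrite symbol_corner_edge CE cE.
  by rewrite (nth_map ord0) // size_s.
exists C; apply/seteqP; split=> [_ [k _ <-]|_ [i _ <-]].
  by rewrite edgeE; exists (nth ord0 s k).
have ks : index i s < n.+1 by rewrite -[X in _ < X]size_s index_mem.
by exists (Ordinal ks) => //; rewrite edgeE nth_index.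
Qed.

Lemma link_adjacent_precedes e f : link_adjacent e f -> e <> f ->
  (precedes (symbol e) (symbol f) \/ precedes (symbol f) (symbol e)) /\
  corner_word (symbol e) = corner_word (symbol f).
Proof.
move=> [s sE] ef.
have [i _ ie] : link_simplex s e by rewrite sE; left.
have [j _ jf] : link_simplex s f by rewrite sE; right.
split; last by rewrite -ie -jf !corner_word_corner_edge.
case: (ltngtP i j) => [|| /ord_inj ij]; last by case: ef; rewrite -ie -jf ij.
  by move/(corner_edge_precedes s); rewrite ie jf; left.
by move/(corner_edge_precedes s); rewrite ie jf; right.
Qed.

Lemma squier_component_npc : nonpositively_curved Y.
Proof.
split; first by split; [exact: corner_edge_inj | exact: link_simplex_inj].
move=> n e e_inj adj.
have prec i j (ij : i != j) : _ := link_adjacent_precedes (adj i j ij)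
  (fun eij => elimN eqP ij (e_inj i j eij)).
apply: flag_cube => [i|i j /prec[] //].
by have [->|/prec[]] := eqVneq i ord0.
Qed.

(** * Invariants of hyperplanes *)

Lemma same_edge_sym e f : same_edge e f -> same_edge f e.
Proof.
case=> ->; first by left.
by right; rewrite /reverse flipK.
Qed.

Lemma same_edge_trans e f g : same_edge e f -> same_edge f g -> same_edge e g.
Proof.
case=> -> [] ->; [by left|by right|by right|].
by left; rewrite /reverse flipK.
Qed.

Lemma same_edge_eqmod e f :
  same_edge e f -> eqmod_edge (symbol e) (symbol f).
Proof.
case=> ->; first by [].
by symmetry; apply: eqmod_edge_flip; exact: edge_symbol_symbol.
Qed.

Lemma square_symbol s : exists a u v m u' v' b,
  [/\ symbol s = Segment a u v (Segment m u' v' (Word b)),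
    eqmod P u v & eqmod P u' v'].
Proof.
have := over_relations_symbol s; have := dim_symbol s.
case: (symbol s) => [//|a u v [//|m u' v' [b|//]]] _.
move=> [/oriented_relation_eqmod uv [/oriented_relation_eqmod uv' _]].
by exists a, u, v, m, u', v', b.
Qed.

Lemma symbol_component_face n (c : cube Y n.+1) (i : 'I_n.+1) (d : bool) :
  symbol (face i d c) = symbol_face i d (symbol c).
Proof. by []. Qed.

Lemma ord2P (i : 'I_2) : i = ord0 \/ i = ord_max.
Proof. by case: i => -[|[|//]] ?; [left|right]; exact: val_inj. Qed.

(** Crossing a square rewrites only one outer word of the edge; the relation applied, with its
    direction, is unchanged. *)
Lemma opposite_sides_eqmod e f : opposite_sides e f ->
  eqmod_edge (symbol e) (symbol f) /\
  sides_at 0 (symbol e) = sides_at 0 (symbol f).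
Proof.
move=> [s [i [-> ->]]]; rewrite !symbol_component_face.
have [a [u [v [m [u' [v' [b [-> uv uv']]]]]]]] := square_symbol s.
case: (ord2P i) => -> /=; split=> //; split=> //=.
  by rewrite uv.
by rewrite uv'.
Qed.

Lemma oriented_parallel_eqmod e f : oriented_parallel e f ->
  eqmod_edge (symbol e) (symbol f) /\
  sides_at 0 (symbol e) = sides_at 0 (symbol f).
Proof.
elim=> {e f} [e f /opposite_sides_eqmod //|//|e f _ [ef ->]|e f g _ [ef ->] _ [fg ->]].
  by split; first by symmetry.
by split; first by transitivity (symbol f).
Qed.

Lemma parallel_eqmod e f : parallel e f -> eqmod_edge (symbol e) (symbol f).
Proof.
elim=> {e f} [e f [/same_edge_eqmod|/opposite_sides_eqmod[]] //|//|e f _ ef|].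
  by symmetry.
by move=> e f g _ ef _ fg; transitivity (symbol f).
Qed.

Lemma hyperplane_eqmod (J : set (edge Y)) e f : hyperplane J -> J e -> J f ->
  eqmod_edge (symbol e) (symbol f).
Proof.
move=> [g ->] /parallel_eqmod ge /parallel_eqmod gf.
by transitivity (symbol g); first by symmetry.
Qed.

Lemma nonparallel_sides_left_of e f : nonparallel_sides e f ->
  left_of (symbol e) (symbol f) \/ left_of (symbol f) (symbol e).
Proof.
move=> [s [i [j [ij [b /same_edge_eqmod se] [b' /same_edge_eqmod sf]]]]].
(* Fixing the last coordinate leaves an edge moving in the first segment, that is, the left one. The
   witness is the middle word of the square, and modulo [P] all choices of faces look alike. *)
have faces (d d' : bool) :
    left_of (symbol (face ord_max d s)) (symbol (face ord0 d' s)).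
  rewrite !symbol_component_face.
  have [a [u [v [m [u' [v' [w [-> uv uv']]]]]]]] := square_symbol s.
  exists m; rewrite /lhs /=; split; first by case: d'; rewrite -!catA -?uv.
  by case: d; rewrite -!catA -?uv'.
case: (ord2P i) (ord2P j) ij se sf => -> [] -> // _ se sf.
  by right; exact: left_of_eqmod sf se (faces _ _).
by left; exact: left_of_eqmod se sf (faces _ _).
Qed.

(** * Edges with a common endpoint and the squares they span *)

Lemma corner_word_source e f : source e = source f ->
  corner_word (symbol e) = corner_word (symbol f).
Proof.
move=> /(congr1 (fun y : vertex Y => corner_word (symbol y))).
by rewrite !symbol_component_face !corner_word_face.
Qed.

Lemma source_reverse e : source (reverse e) = target e.
Proof. by rewrite /source /reverse face_flip. Qed.

Lemma common_endpoint_source e f : common_endpoint e f ->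
  exists e' f', [/\ same_edge e e', same_edge f f' & source e' = source f'].
Proof.
move=> [x [xe xf]].
have reorient g : x = source g \/ x = target g ->
    exists2 g', same_edge g g' & source g' = x.
  case=> ->; first by exists g; first by left.
  by exists (reverse g); [right | exact: source_reverse].
have [e' ee' e'x] := reorient e xe; have [f' ff' f'x] := reorient f xf.
by exists e', f'; rewrite e'x f'x.
Qed.

Lemma side_same_edge s i e e' : side s i e -> same_edge e e' -> side s i e'.
Proof. by move=> [b se] ee'; exists b; exact: same_edge_trans se ee'. Qed.

Lemma in_same_square_same_edge e e' f f' : same_edge e e' -> same_edge f f' ->
  in_same_square e f -> in_same_square e' f'.
Proof.
move=> ee' ff' [s [i [j [se sf]]]]; exists s, i, j.
by split; [exact: side_same_edge se ee' | exact: side_same_edge sf ff'].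
Qed.

Lemma in_same_square_sym e f : in_same_square e f -> in_same_square f e.
Proof. by move=> [s [i [j [se sf]]]]; exists s, j, i. Qed.

Lemma side_corner_edge s i : exists j, side s j (corner_edge s i).
Proof.
case: (ord2P i) => ->; [exists ord_max|exists ord0]; exists false; left=> /=.
  by case: unliftP.
case: unliftP => [j _ //|/(congr1 val) //].
Qed.

(** This is [flag_cube] for two edges: disjoint occurrences in one word span a square. *)
Lemma precedes_in_same_square e f : source e = source f ->
  precedes (symbol e) (symbol f) -> in_same_square e f.
Proof.
move=> /corner_word_source ef prec.
pose g (i : 'I_2) := if i == ord0 then e else f.
have [|i j ij|s sE] := @flag_cube 1 g.
- by move=> i; rewrite /g; case: ifP.
- case: (ord2P i) (ord2P j) ij => -> [] -> // _; [by left|by right].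
have [i _ si] : link_simplex s e by rewrite sE; exists ord0.
have [j _ sj] : link_simplex s f by rewrite sE; exists ord_max.
have [i' ?] := side_corner_edge s i; have [j' ?] := side_corner_edge s j.
by exists s, i', j'; rewrite -si -sj.
Qed.

Lemma squier_hyperplane_two_sided (J : set (edge Y)) : two_sided J.
Proof.
move=> _ [e _ ->] opp.
have : oriented_hyperplane_of e e by exact: rst_refl.
rewrite opp => -[f /oriented_parallel_eqmod[_ ef] fe].
(* Here [e] is the reverse of an edge [f] with the same ordered pair of sides as [e], so the two
   sides of [e] coincide, which the asymmetry of the relations forbids. *)
have := sides_at_flip 0 (symbol f).
rewrite -[symbol_flip 0 _]/(symbol (reverse f)) fe -ef => ee.
apply: (@sides_at_neq _ P 0 (symbol e)).
- exact: over_relations_symbol.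
- by rewrite dim_symbol.
by rewrite {1}ee.
Qed.

(** Both edges apply the same [u -> v] to the same word, in contexts equal modulo [P]; by
    [shifted_occurrences_absorbing] the contexts are then equal as words. This excludes
    self-osculation. *)
Lemma same_hyperplane_source e f : ~ absorbing w0 -> oriented_parallel e f ->
  source e = source f -> e = f.
Proof.
move=> w0A /oriented_parallel_eqmod[[l _ r] sides] /corner_word_source ef.
have := eqmod_corner_word e; have := ef.
rewrite !corner_word_edge ?dim_symbol //.
rewrite {2}/lhs -sides -/(lhs (symbol e)) => efw w0e.
have [//|[le re]] := shifted_occurrences_absorbing w0e efw l r.
apply: symbol_inj; rewrite (edge_symbol_eta (dim_symbol e)).
by rewrite (edge_symbol_eta (dim_symbol f)) /lhs le re sides.
Qed.

(** Flipping the other coordinate of a square reverses both opposite sides at once. This reduces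
    osculation at terminal points to osculation at initial points. *)
Lemma oriented_parallel_reverse e f :
  oriented_parallel e f -> oriented_parallel (reverse e) (reverse f).
Proof.
elim=> {e f} [_ _ [s [i [-> ->]]]|e|e f _|e f g _ IH _ IH'].
- by apply: rst_step; exists (flip (lift i ord0) s), i; rewrite !face_flip_lift.
- exact: rst_refl.
- exact: rst_sym.
- exact: rst_trans IH IH'.
Qed.

Lemma squier_component_special : ~ absorbing w0 -> special Y.
Proof.
move=> w0A; split; first exact: squier_component_npc.
  move=> J HJ; split; first exact: squier_hyperplane_two_sided.
  - move=> [e [f [Je Jf /nonparallel_sides_left_of ef]]].
    (* Edges of one hyperplane are interchangeable for [left_of], so a self-intersection puts [e] to
       the left of itself. *)
    have {}ef : left_of (symbol e) (symbol e).
      have eqfe := hyperplane_eqmod HJ Jf Je.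
      by case: ef => /left_of_eqmod; apply.
    apply: w0A; apply: left_of_self_absorbing ef.
      exact: edge_symbol_symbol.
    exact: eqmod_corner_word.
  - move=> [_ [g _ ->] [e [f [ge gf ef ends _]]]].
    have {ge gf} par : oriented_parallel e f.
      by apply: rst_trans gf; exact: rst_sym.
    case: ends; first by move/(same_hyperplane_source w0A par).
    rewrite -!source_reverse.
    move/(same_hyperplane_source w0A (oriented_parallel_reverse par)).
    by move=> /(congr1 (@reverse _)); rewrite /reverse !flipK.
(* Transversality places an edge of one hyperplane to the left of an edge of the other. Transported
   to the reoriented edges [e'] and [f'] with common source, this makes their occurrences disjoint,
   so they span a square. *)
move=> J K HJ HK _ [[e0 [f0 [Je0 Kf0 /nonparallel_sides_left_of trans]]]].
move=> [e [f [Je Kf /common_endpoint_source[e' [f' [ee' ff' ends]]] nsq]]].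
apply: nsq.
apply: (in_same_square_same_edge (same_edge_sym ee') (same_edge_sym ff')).
have {Je0 Je ee'} E : eqmod_edge (symbol e0) (symbol e').
  by transitivity (symbol e); [exact: hyperplane_eqmod Je0 Je|exact: same_edge_eqmod].
have {Kf0 Kf ff'} F : eqmod_edge (symbol f0) (symbol f').
  by transitivity (symbol f); [exact: hyperplane_eqmod Kf0 Kf|exact: same_edge_eqmod].
have square_of g h : source g = source h -> left_of (symbol g) (symbol h) ->
    in_same_square g h.
  move=> gh lgh.
  have := left_of_precedes (edge_symbol_symbol g) (edge_symbol_symbol h)
    (eqmod_corner_word g) (corner_word_source gh) lgh.
  by case=> //; exact: precedes_in_same_square.
case: trans => trans; last apply: in_same_square_sym; apply: square_of => //.
  exact: left_of_eqmod trans.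
exact: left_of_eqmod trans.
Qed.

End SquierComplex.

Theorem corollary3p7 (Sigma : Type) (P : presentation Sigma) (w0 : seq Sigma)
    (w0_nonempty : w0 <> [::]) :
  ((~ exists a b p : seq Sigma,
        (a <> [::] /\ b <> [::] /\ p <> [::]) /\
        [/\ eqmod P w0 (a ++ b), eqmod P a (a ++ p) & eqmod P b (p ++ b)]) ->
     special (squier_component P w0)) /\
  (finite_set (word_class P w0) -> special (squier_component P w0)).
Proof.
split=> [|fin]; first exact: squier_component_special.
by apply: squier_component_special => /absorbing_infinite.
Qed.
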